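(* Let $\alpha\ge0$ and let $f:\mathbb{N}_0\to\mathbb{C}$ be a sequence with finite support. Then $$W^\alpha T(t)f(n)=e^{-t\alpha}\,T(t)W^\alpha f(n),\qquad t\ge0,\ n\in\mathbb{N}_0.$$
   Context: $\mathbb{N}_0=\{0,1,2,\ldots\}$ and $0^0=1$. For $\gamma\in\mathbb{C}$ put $k^\gamma(0)=1$ and $k^\gamma(n)=\frac{\gamma(\gamma+1)\cdots(\gamma+n-1)}{n!}$ for $n\ge1$. For $t\ge0$, $$T(t)f(n)=\sum_{j=0}^n\binom nj e^{-tj}(1-e^{-t})^{n-j}f(j),\qquad n\in\mathbb{N}_0.$$ Fractional differences: for $f:\mathbb{N}_0\to\mathbb{C}$ and $\alpha>0$, $W^{-\alpha}f(n)=\sum_{j=n}^\infty k^\alpha(j-n)f(j)$ whenever this makes sense; $W^1f(n)=f(n)-f(n+1)$, $W^m$ is the $m$-fold iterate of $W^1$ for integers $m\ge1$; and for $\alpha>0$, $W^\alpha f=W^mW^{-(m-\alpha)}f$ with $m=[\alpha]+1$, whenever this makes sense (for integer $\alpha$ this is the iterated difference). $W^0$ is the identity. *)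

(* Defs.v *)
From Stdlib Require Import Reals Lra Lia ZArith List.
From Coquelicot Require Import Coquelicot.
Open Scope R_scope.

Definition finite_support (f : nat -> C) : Prop :=
  exists l : list nat, forall n, f n <> RtoC 0 -> In n l.

Fixpoint Crising (g : C) (n : nat) : C :=
  match n with
  | O => RtoC 1
  | S p => (Crising g p * (g + RtoC (INR p)))%C
  end.

Definition kern (g : C) (n : nat) : C := (Crising g n / RtoC (INR (fact n)))%C.

(* At t = 0 the value 0 ^ 0 = 1 of [pow] is used. *)
Definition T (t : R) (f : nat -> C) (n : nat) : C :=
  sum_n (fun j => (RtoC (Binomial.C n j * exp (- (t * INR j))
                         * (1 - exp (- t)) ^ (n - j)) * f j)%C) n.

(* Coquelicot's total [Series] is real-valued; the result is meaningful
   when the series converges in C, see [CSeries_correct]. *)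
Definition CSeries (a : nat -> C) : C :=
  (Series (fun n => Re (a n)), Series (fun n => Im (a n))).

Lemma sum_n_C (a : nat -> C) n :
  sum_n a n = (sum_n (fun k => Re (a k)) n, sum_n (fun k => Im (a k)) n).
Proof.
  induction n as [|n IH].
  - rewrite !sum_O. now destruct (a O).
  - rewrite !sum_Sn, IH. now destruct (a (S n)).
Qed.

Lemma CSeries_unique (a : nat -> C) (l : C) : is_series a l -> CSeries a = l.
Proof.
  intros H. destruct l as [x y]. unfold CSeries. f_equal.
  - apply is_series_unique. intros P [e He].
    destruct (H (fun z : C => P (fst z))) as [N HN].
    + exists e. intros z [Hz _]. now apply He.
    + exists N. intros n Hn. specialize (HN n Hn). now rewrite sum_n_C in HN.
  - apply is_series_unique. intros P [e He].
    destruct (H (fun z : C => P (snd z))) as [N HN].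
    + exists e. intros z [_ Hz]. now apply He.
    + exists N. intros n Hn. specialize (HN n Hn). now rewrite sum_n_C in HN.
Qed.

Lemma CSeries_correct (a : nat -> C) : ex_series a -> is_series a (CSeries a).
Proof. intros [l Hl]. now rewrite (CSeries_unique a l Hl). Qed.

(* Sums over j >= n are indexed by i = j - n. *)
Definition Wneg_term (a : R) (f : nat -> C) (n i : nat) : C :=
  (kern (RtoC a) i * f (n + i)%nat)%C.

Definition Wneg_defined (a : R) (f : nat -> C) : Prop :=
  forall n, ex_series (Wneg_term a f n).

Definition Wneg (a : R) (f : nat -> C) (n : nat) : C :=
  CSeries (Wneg_term a f n).

Definition W1 (f : nat -> C) (n : nat) : C := (f n - f (S n))%C.

Definition Witer (m : nat) (f : nat -> C) : nat -> C := Nat.iter m W1 f.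

Definition Word (a : R) : nat := S (Z.to_nat (Int_part a)).

(* Only meaningful for a >= 0 with [W_defined a f]. *)
Definition W (a : R) (f : nat -> C) : nat -> C :=
  if Req_dec_T a 0 then f
  else Witer (Word a) (Wneg (INR (Word a) - a) f).

Definition W_defined (a : R) (f : nat -> C) : Prop :=
  0 < a -> Wneg_defined (INR (Word a) - a) f.

Lemma Crising_1 n : Crising (RtoC 1) n = RtoC (INR (fact n)).
Proof.
  induction n as [|n IH]; [reflexivity|].
  simpl Crising. rewrite IH, <- RtoC_plus, <- RtoC_mult. f_equal.
  rewrite fact_simpl, mult_INR, S_INR. ring.
Qed.

Lemma kern_1 n : kern (RtoC 1) n = RtoC 1.
Proof.
  unfold kern. rewrite Crising_1. apply Cinv_r.
  intros H. apply RtoC_inj in H. now apply (INR_fact_neq_0 n).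
Qed.

Lemma Word_INR m : Word (INR m) = S m.
Proof.
  unfold Word. f_equal. rewrite Int_part_INR. apply Nat2Z.id.
Qed.

Lemma W1_Wneg_1 f n : Wneg_defined 1 f -> W1 (Wneg 1 f) n = f n.
Proof.
  intros H. unfold W1.
  assert (E : is_series (Wneg_term 1 f n) (plus (Wneg 1 f (S n)) (f n))).
  { replace (f n) with (Wneg_term 1 f n 0).
    - apply is_series_decr_1.
      match goal with |- is_series _ ?x =>
        replace x with (Wneg 1 f (S n)) end.
      + apply (is_series_ext (Wneg_term 1 f (S n))).
        * intros i. unfold Wneg_term. rewrite !kern_1.
          now replace (n + S i)%nat with (S n + i)%nat by lia.
        * apply CSeries_correct, H.
      + change plus with Cplus. change opp with Copp. ring.
    - unfold Wneg_term. rewrite kern_1, Nat.add_0_r. ring. }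
  unfold Wneg at 1. rewrite (CSeries_unique _ _ E).
  change plus with Cplus. ring.
Qed.

(* Consistency at positive integer order. *)
Lemma W_INR m f n :
  (0 < m)%nat -> W_defined (INR m) f -> W (INR m) f n = Witer m f n.
Proof.
  intros Hm H. assert (Hp := lt_0_INR m Hm). specialize (H Hp).
  unfold W. destruct (Req_dec_T (INR m) 0) as [|_]; [lra|].
  rewrite Word_INR in *.
  replace (INR (S m) - INR m) with 1 in * by (rewrite S_INR; ring).
  assert (G : forall k j,
            Witer (S k) (Wneg 1 f) j = Witer k f j).
  { induction k as [|k IH]; intros j.
    - apply W1_Wneg_1, H.
    - change (W1 (Witer (S k) (Wneg 1 f)) j = W1 (Witer k f) j).
      unfold W1. now rewrite !IH. }
  apply G.
Qed.

(* Main.v *)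
(** Write [q = exp (- t)].  Pascal's rule says that [T t g (n + 1)] is
    [(1 - q) T t g n + q T t (g (1 + _)) n].  Hence [W^1 T t g = q T t W^1 g]
    pointwise for every [g], and it remains to treat [W^(-b)] with [b > 0], where
    [W^(-b) T t f = q ^ (-b) T t W^(-b) f]. The same rule propagates this
    identity from [n] to [n + 1] for all finitely supported [f] at once, which
    leaves [n = 0].  There, by linearity, [f] is a point mass at [K], and
    [k^b(K+i) C(K+i,K) = k^b(K) k^(b+K)(i)] turns the claim into the negative
    binomial series at [1 - q]. *)
Require Import Defs.
From Stdlib Require Import Reals Lra Lia ZArith List.
From Coquelicot Require Import Coquelicot.
Open Scope R_scope.

(** * Series and finite sums *)

Lemma is_series_RtoC (a : nat -> R) (l : R) :
  is_series a l -> is_series (fun n => RtoC (a n)) (RtoC l).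
Proof.
  intros H P [e He].
  destruct (H (fun x => P (RtoC x))) as [N HN].
  - exists e. intros x Hx. apply He. split; [exact Hx|apply ball_center].
  - exists N. intros n Hn. specialize (HN n Hn).
    refine (eq_ind _ P HN _ _). clear. induction n as [|n IH].
    + now rewrite !sum_O.
    + rewrite !sum_Sn, <- IH. apply RtoC_plus.
Qed.

(** The binomial weights at a fixed [K] vanish for [i < K], so their series may be started at
    [K]. *)
Lemma is_series_drop_zeros {K : AbsRing} {V : NormedModule K}
    (a : nat -> V) (N : nat) (l : V) :
  (forall i, (i < N)%nat -> a i = zero) ->
  is_series (fun i => a (N + i)%nat) l -> is_series a l.
Proof.
  revert a. induction N as [|N IH]; intros a Hz H.
  - exact H.
  - apply is_series_decr_1. rewrite Hz by lia.
    assert (E : plus l (opp zero) = l)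
      by (etransitivity; [apply f_equal, opp_zero|apply plus_zero_r]).
    refine (eq_ind_r (is_series _) _ E).
    apply (IH (fun k => a (S k))); [|exact H].
    intros i Hi. apply Hz. lia.
Qed.

(** Pascal's rule links index [j + 1] to [j], which calls for splitting off the term at 0. *)
Lemma sum_n_first {G : AbelianMonoid} (a : nat -> G) (n : nat) :
  sum_n a (S n) = plus (a 0%nat) (sum_n (fun j => a (S j)) n).
Proof.
  induction n as [|n IH].
  - now rewrite sum_Sn, !sum_O.
  - now rewrite sum_Sn, IH, sum_Sn, plus_assoc.
Qed.

(* [ring] recognises only the concrete operations of C, not the projections
   of its Coquelicot structures. *)
Ltac C_fold :=
  repeat match goal with
  | |- context [@plus ?G] => change (@plus G) with Cplus
  | |- context [@mult ?K] => change (@mult K) with Cmult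
  | |- context [@scal ?K ?V] => change (@scal K V) with Cmult
  | |- context [@sum_n (Ring.AbelianMonoid C_Ring)] =>
      change (@sum_n (Ring.AbelianMonoid C_Ring))
        with (@sum_n C_AbelianMonoid)
  | |- @eq ?A ?x ?y => lazymatch A with C => fail | _ => change (@eq C x y) end
  end.

Ltac C_ring := C_fold; ring.

(** * The negative binomial series *)

(** The real form of [kern], built from the ratio [(a + n) / (n + 1)] of consecutive values; this
    ratio yields both the radius of convergence and the differential equation. *)
Fixpoint rkern (a : R) (n : nat) : R :=
  match n with
  | O => 1
  | S p => rkern a p * (a + INR p) / INR (S p)
  end.

Lemma rkern_S (a : R) (n : nat) :
  rkern a (S n) = rkern a n * (a + INR n) / INR (S n).
Proof. reflexivity. Qed.

Lemma kern_RtoC (a : R) (n : nat) : kern (RtoC a) n = RtoC (rkern a n).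
Proof.
  unfold kern.
  assert (E : Crising (RtoC a) n = RtoC (rkern a n * INR (fact n))).
  { induction n as [|n IH].
    - simpl. f_equal. ring.
    - simpl Crising. rewrite IH, <- RtoC_plus, <- RtoC_mult. f_equal.
      rewrite fact_simpl, mult_INR. rewrite rkern_S. field.
      apply (not_0_INR (S n)). lia. }
  rewrite E, <- RtoC_div; [|apply INR_fact_neq_0].
  f_equal. field. apply INR_fact_neq_0.
Qed.

Lemma rkern_pos (a : R) (n : nat) : 0 < a -> 0 < rkern a n.
Proof.
  intros Ha. induction n as [|n IH]; [exact Rlt_0_1|]. rewrite rkern_S.
  assert (0 < INR (S n)) by (apply lt_0_INR; lia).
  assert (0 <= INR n) by apply pos_INR.
  apply Rdiv_lt_0_compat; [|assumption].
  apply Rmult_lt_0_compat; lra.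
Qed.

(** From [i] to [i + 1] both sides gain the factor [(b + N + i) / (i + 1)]: the denominator
    [N + i + 1] of the kernel ratio cancels the numerator of the binomial ratio. *)
Lemma rkern_shift (b : R) (N i : nat) :
  rkern b (N + i) * Binomial.C (N + i) N = rkern b N * rkern (b + INR N) i.
Proof.
  induction i as [|i IH].
  - rewrite Nat.add_0_r, C_n_n. simpl. ring.
  - rewrite Nat.add_succ_r, pascal_step2 by lia.
    replace (S (N + i) - N)%nat with (S i) by lia.
    rewrite !rkern_S, plus_INR.
    transitivity (rkern b (N + i) * Binomial.C (N + i) N
                  * (b + (INR N + INR i)) / INR (S i)).
    + field. split; apply not_0_INR; lia.
    + rewrite IH. field. apply not_0_INR; lia.
Qed.

Lemma CV_radius_rkern (a : R) : 0 < a -> CV_radius (rkern a) = 1.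
Proof.
  intros Ha. replace (Finite 1) with (Finite (/ 1)) by (f_equal; field).
  apply CV_radius_finite_DAlembert.
  - intros n. apply Rgt_not_eq, rkern_pos, Ha.
  - lra.
  - apply (is_lim_seq_ext (fun n => 1 + (a - 1) * / INR (S n))).
    + intros n. assert (0 < INR (S n)) by (apply lt_0_INR; lia).
      assert (0 <= INR n) by apply pos_INR.
      assert (P := rkern_pos a n Ha).
      replace (rkern a (S n) / rkern a n) with ((a + INR n) / INR (S n)).
      * rewrite Rabs_pos_eq.
        -- rewrite S_INR in *. field. lra.
        -- apply Rdiv_le_0_compat; lra.
      * rewrite rkern_S. field. split; lra.
    + replace (Finite 1) with (Finite (1 + (a - 1) * 0)) by (f_equal; ring).
      apply is_lim_seq_plus'; [apply is_lim_seq_const|].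
      apply (is_lim_seq_scal_l _ _ 0).
      apply (is_lim_seq_incr_1 (fun n => / INR n)).
      replace (Finite 0) with (Rbar_inv p_infty) by reflexivity.
      apply is_lim_seq_inv; [apply is_lim_seq_INR|discriminate].
Qed.

(** For the power series [F] with coefficients [k = rkern a], the relation
    [(n + 1) k(n + 1) = a k(n) + n k(n)] says [F' = a F + x F']. *)
Lemma PSeries_rkern_ode (a x : R) : 0 < a -> Rabs x < 1 ->
  PSeries (PS_derive (rkern a)) x * (1 - x) = a * PSeries (rkern a) x.
Proof.
  intros Ha Hx.
  assert (R1 : Rbar_lt (Rabs x) (CV_radius (rkern a)))
    by (rewrite CV_radius_rkern by assumption; exact Hx).
  assert (E : PSeries (PS_derive (rkern a)) x
    = PSeries (PS_plus (PS_scal a (rkern a))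
                       (PS_incr_1 (PS_derive (rkern a)))) x).
  { apply PSeries_ext. intros n. unfold PS_derive, PS_plus, PS_scal, PS_incr_1.
    change (INR (S n) * rkern a (S n) = a * rkern a n
      + match n with O => 0 | S p => INR (S p) * rkern a (S p) end).
    assert (INR (S n) <> 0) by (apply not_0_INR; lia).
    rewrite rkern_S.
    destruct n as [|n]; field_simplify; auto.
    simpl. ring. }
  rewrite PSeries_plus, PSeries_scal, PSeries_incr_1 in E.
  - lra.
  - apply ex_pseries_scal; [apply Rmult_comm|]. now apply CV_radius_inside.
  - apply ex_pseries_incr_1, CV_radius_inside. now rewrite CV_radius_derive.
Qed.

(** By the differential equation, [F(y) (1 - y)^a] has derivative 0, and its value at 0 is 1. *)
Lemma PSeries_rkern (a x : R) : 0 < a -> 0 <= x < 1 ->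
  PSeries (rkern a) x = Rpower (1 - x) (- a).
Proof.
  intros Ha [H0 H1].
  set (G := fun y => PSeries (rkern a) y * Rpower (1 - y) a).
  assert (E : G 0 = G x).
  { destruct H0 as [H0|H0]; [|now rewrite <- H0].
    apply eq_is_derive; [|exact H0]. intros y Hy.
    assert (Hy1 : Rabs y < 1) by (rewrite Rabs_pos_eq; lra).
    assert (D1 : is_derive (PSeries (rkern a)) y
                   (PSeries (PS_derive (rkern a)) y)).
    { apply is_derive_PSeries. rewrite CV_radius_rkern by assumption.
      exact Hy1. }
    assert (D2 : is_derive (fun z => Rpower (1 - z) a) y
                   (scal (-1) (a * Rpower (1 - y) (a - 1)))).
    { apply (is_derive_comp (fun z => Rpower z a) (fun z => 1 - z)).
      - apply is_derive_Reals, derivable_pt_lim_power. lra.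
      - auto_derive; [exact I|ring]. }
    assert (D := is_derive_mult _ _ y _ _ D1 D2 Rmult_comm).
    eapply is_derive_ext; [intros z; reflexivity|].
    replace (@zero R_NormedModule) with
      (plus (mult (PSeries (PS_derive (rkern a)) y) (Rpower (1 - y) a))
        (mult (PSeries (rkern a) y)
          (scal (-1) (a * Rpower (1 - y) (a - 1))))); [exact D|].
    change (PSeries (PS_derive (rkern a)) y * Rpower (1 - y) a
      + PSeries (rkern a) y * (-1 * (a * Rpower (1 - y) (a - 1))) = 0).
    assert (O := PSeries_rkern_ode a y Ha Hy1).
    (* Splitting off one factor [1 - y] lets the differential equation apply. *)
    replace (Rpower (1 - y) a) with (Rpower (1 - y) (a - 1) * (1 - y)).
    - replace (PSeries (PS_derive (rkern a)) y
        * (Rpower (1 - y) (a - 1) * (1 - y)))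
        with (PSeries (PS_derive (rkern a)) y * (1 - y)
              * Rpower (1 - y) (a - 1)) by ring.
      rewrite O. ring.
    - rewrite <- (Rpower_1 (1 - y)) at 2 by lra.
      rewrite <- Rpower_plus. f_equal. ring. }
  unfold G in E. rewrite PSeries_0, Rminus_0_r in E.
  replace (Rpower 1 a) with 1 in E
    by (unfold Rpower; now rewrite ln_1, Rmult_0_r, exp_0).
  simpl in E. rewrite Rpower_Ropp.
  assert (P : 0 < Rpower (1 - x) a) by apply exp_pos.
  apply (Rmult_eq_reg_r (Rpower (1 - x) a)); [|lra].
  rewrite <- E. field. lra.
Qed.

Lemma is_series_rkern (a x : R) : 0 < a -> 0 <= x < 1 ->
  is_series (fun n => rkern a n * x ^ n) (Rpower (1 - x) (- a)).
Proof.
  intros Ha Hx. rewrite <- PSeries_rkern by assumption.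
  apply is_pseries_R, PSeries_correct, CV_radius_inside.
  rewrite CV_radius_rkern by assumption. simpl. rewrite Rabs_pos_eq; lra.
Qed.

(** * Binomial weights *)

(* [Binomial.C n j] is a nonzero junk value for [j > n]; with the value 0
   there Pascal's rule holds without side condition. *)
Definition bern (q : R) (n j : nat) : R :=
  if Nat.leb j n then Binomial.C n j * q ^ j * (1 - q) ^ (n - j) else 0.

Lemma bern_gt (q : R) (n j : nat) : (n < j)%nat -> bern q n j = 0.
Proof.
  intros H. unfold bern. now rewrite (proj2 (Nat.leb_gt _ _) H).
Qed.

Lemma bern_le (q : R) (n j : nat) : (j <= n)%nat ->
  bern q n j = Binomial.C n j * q ^ j * (1 - q) ^ (n - j).
Proof.
  intros H. unfold bern. now rewrite (proj2 (Nat.leb_le _ _) H).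
Qed.

Lemma bern_S_0 (q : R) (n : nat) : bern q (S n) 0 = (1 - q) * bern q n 0.
Proof.
  rewrite !bern_le by lia. rewrite !C_n_0, !Nat.sub_0_r. simpl. ring.
Qed.

Lemma bern_S_S (q : R) (n j : nat) :
  bern q (S n) (S j) = q * bern q n j + (1 - q) * bern q n (S j).
Proof.
  destruct (Nat.lt_trichotomy j n) as [H|[->|H]].
  - rewrite !bern_le by lia. rewrite <- pascal by assumption.
    replace (S n - S j)%nat with (S (n - S j)) by lia.
    replace (n - j)%nat with (S (n - S j)) by lia. simpl. ring.
  - rewrite (bern_gt _ n (S n)) by lia. rewrite !bern_le by lia.
    rewrite !C_n_n, !Nat.sub_diag. simpl. ring.
  - rewrite !bern_gt by lia. ring.
Qed.

Lemma exp_mult_INR (t : R) (j : nat) : exp (- (t * INR j)) = exp (- t) ^ j.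
Proof.
  induction j as [|j IH].
  - simpl. now rewrite Rmult_0_r, Ropp_0, exp_0.
  - simpl pow. rewrite <- IH, <- exp_plus, S_INR. f_equal. ring.
Qed.

(** * The operators [T t] and integer differences *)

Lemma T_bern (t : R) (f : nat -> C) (n : nat) :
  T t f n = sum_n (fun j => (RtoC (bern (exp (- t)) n j) * f j)%C) n.
Proof.
  apply sum_n_ext_loc. intros j Hj.
  now rewrite exp_mult_INR, bern_le by assumption.
Qed.

Lemma T_ext (t : R) (f g : nat -> C) (n : nat) :
  (forall j, f j = g j) -> T t f n = T t g n.
Proof. intros H. apply sum_n_ext. intros j. now rewrite H. Qed.

Lemma T_plus (t : R) (f g : nat -> C) (n : nat) :
  T t (fun j => (f j + g j)%C) n = (T t f n + T t g n)%C.
Proof.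
  unfold T. etransitivity; [|apply (sum_n_plus (G := C_AbelianMonoid))].
  apply sum_n_ext. intros j. apply Cmult_plus_distr_l.
Qed.

Lemma T_scal (t : R) (c : C) (f : nat -> C) (n : nat) :
  T t (fun j => (c * f j)%C) n = (c * T t f n)%C.
Proof.
  unfold T. etransitivity; [|apply (sum_n_mult_l (K := C_Ring))].
  apply sum_n_ext. intros j. C_ring.
Qed.

Lemma T_S (t : R) (g : nat -> C) (n : nat) :
  T t g (S n) = (RtoC (1 - exp (- t)) * T t g n
                 + RtoC (exp (- t)) * T t (fun j => g (S j)) n)%C.
Proof.
  rewrite !T_bern. set (q := exp (- t)).
  (* A term of weight 0 is added at [n + 1], so that all sums have the same range once the terms at
     0 are split off. *)
  assert (E : sum_n (fun j => (RtoC (bern q n j) * g j)%C) n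
              = sum_n (fun j => (RtoC (bern q n j) * g j)%C) (S n)).
  { rewrite sum_Sn, (bern_gt q n (S n)) by lia. symmetry. C_ring. }
  rewrite E, !sum_n_first, bern_S_0. clear E.
  C_fold.
  rewrite (sum_n_ext (fun j => (RtoC (bern q (S n) (S j)) * g (S j))%C)
     (fun j => plus (mult (RtoC q) (RtoC (bern q n j) * g (S j))%C)
        (mult (RtoC (1 - q)) (RtoC (bern q n (S j)) * g (S j))%C))).
  - rewrite (sum_n_plus (G := C_AbelianMonoid)),
      !(sum_n_mult_l (K := C_Ring)).
    C_fold.
    rewrite RtoC_mult. ring.
  - intros j. rewrite bern_S_S, RtoC_plus, !RtoC_mult.
    C_ring.
Qed.

Lemma W1_T (t : R) (g : nat -> C) (n : nat) :
  W1 (T t g) n = (RtoC (exp (- t)) * T t (W1 g) n)%C.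
Proof.
  unfold W1 at 1. rewrite T_S, RtoC_minus.
  rewrite (T_ext t (W1 g) (fun j => (g j + - RtoC 1 * g (S j))%C)).
  - rewrite T_plus, (T_scal t (- RtoC 1)%C (fun j => g (S j))). ring.
  - intros j. unfold W1. ring.
Qed.

Lemma Witer_ext (m : nat) (f g : nat -> C) (n : nat) :
  (forall j, f j = g j) -> Witer m f n = Witer m g n.
Proof.
  intros H. revert n. induction m as [|m IH]; intros n; [apply H|].
  change (W1 (Witer m f) n = W1 (Witer m g) n). unfold W1. now rewrite !IH.
Qed.

(** Each application of [W1] contributes one factor [exp (- t)]. The constant [c] is there to carry
    the factor produced by the negative order. *)
Lemma Witer_scal_T (m : nat) (c : C) (t : R) (g : nat -> C) (n : nat) :
  Witer m (fun j => (c * T t g j)%C) n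
  = (c * (RtoC (exp (- (t * INR m))) * T t (Witer m g) n))%C.
Proof.
  revert n. rewrite exp_mult_INR. induction m as [|m IH]; intros n.
  - simpl. ring.
  - change (W1 (Witer m (fun j => (c * T t g j)%C)) n
            = (c * (RtoC (exp (- t) ^ S m) * T t (W1 (Witer m g)) n))%C).
    unfold W1 at 1. rewrite !IH. simpl pow. rewrite RtoC_mult.
    transitivity (c * (RtoC (exp (- t) ^ m) * W1 (T t (Witer m g)) n))%C.
    + unfold W1. ring.
    + rewrite W1_T. ring.
Qed.

(** * Negative orders *)

Definition point_mass (K j : nat) : C :=
  if Nat.eqb j K then RtoC 1 else RtoC 0.

Lemma T_point_mass (t : R) (K i : nat) :
  T t (point_mass K) i = RtoC (bern (exp (- t)) i K).
Proof.
  rewrite T_bern.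
  (* The upper limit varies while the row [i] of weights stays fixed. *)
  assert (E : forall n, sum_n (fun j => (RtoC (bern (exp (- t)) i j)
      * point_mass K j)%C) n
    = if Nat.leb K n then RtoC (bern (exp (- t)) i K) else RtoC 0).
  { induction n as [|n IH].
    - rewrite sum_O. unfold point_mass. destruct K; simpl; ring.
    - rewrite sum_Sn, IH. C_fold. unfold point_mass.
      destruct (Nat.eqb_spec (S n) K) as [<-|H].
      + rewrite (proj2 (Nat.leb_gt (S n) n)), Nat.leb_refl by lia. ring.
      + destruct (Nat.leb_spec K n), (Nat.leb_spec K (S n)); try lia; ring. }
  rewrite E. destruct (Nat.leb_spec K i) as [|H]; [reflexivity|].
  now rewrite bern_gt.
Qed.

(** Only the diagonal weight survives, where [0 ^ 0 = 1]. Statements about the series of [f] itself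
    thus become the case [t = 0]. *)
Lemma T_0 (f : nat -> C) (n : nat) : T 0 f n = f n.
Proof.
  unfold T. destruct n as [|n].
  - rewrite sum_O, C_n_n. simpl.
    rewrite Rmult_0_l, Ropp_0, exp_0, !Rmult_1_l. ring.
  - rewrite sum_Sn, C_n_n, Nat.sub_diag, Rmult_0_l, Ropp_0, exp_0.
    rewrite (sum_n_ext_loc _ (fun _ => mult (RtoC 0) (RtoC 0))).
    + rewrite (sum_n_mult_l (K := C_Ring)).
      C_fold. simpl pow.
      rewrite !Rmult_1_l. ring.
    + intros j Hj. C_fold.
      replace (S n - j)%nat with (S (n - j)) by lia. simpl pow.
      rewrite Rminus_diag, !Rmult_0_l, Rmult_0_r. ring.
Qed.

(** With [q = exp (- t)], the terms from [K] on are [k^b(K) q^K k^(b+K)(i) (1 - q)^i], with sum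
    [k^b(K) q^K q^(-(b+K)) = k^b(K) q^(-b)]. *)
Lemma is_series_rkern_bern (b t : R) (K : nat) : 0 < b -> 0 <= t ->
  is_series (fun i => rkern b i * bern (exp (- t)) i K)
            (exp (t * b) * rkern b K).
Proof.
  intros Hb Ht. set (q := exp (- t)).
  assert (Hq : 0 < q <= 1).
  { split; [apply exp_pos|]. rewrite <- exp_0. unfold q.
    destruct Ht as [Ht|<-]; [left; apply exp_increasing; lra|].
    right. f_equal. ring. }
  apply (is_series_drop_zeros _ K).
  - intros i Hi. rewrite bern_gt by assumption. apply Rmult_0_r.
  - assert (HK := pos_INR K).
    assert (HS := is_series_rkern (b + INR K) (1 - q)
                   ltac:(lra) ltac:(lra)).
    apply (is_series_scal (rkern b K * q ^ K)) in HS.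
    replace (exp (t * b) * rkern b K) with
      (scal (rkern b K * q ^ K) (Rpower (1 - (1 - q)) (- (b + INR K)))).
    + eapply is_series_ext; [|exact HS]. intros i.
      change scal with Rmult. rewrite bern_le by lia.
      replace (K + i - K)%nat with i by lia.
      refine (_ : @eq R _ _).
      transitivity (rkern b K * rkern (b + INR K) i * q ^ K * (1 - q) ^ i).
      * ring.
      * rewrite <- rkern_shift. ring.
    + change scal with Rmult.
      replace (1 - (1 - q)) with q by ring.
      unfold Rpower, q. rewrite ln_exp, <- exp_mult_INR.
      rewrite Rmult_assoc, <- exp_plus, Rmult_comm. f_equal. f_equal. ring.
Qed.

Lemma is_series_kern_T_point_mass (b t : R) (K : nat) : 0 < b -> 0 <= t ->
  is_series (fun i => (kern (RtoC b) i * T t (point_mass K) i)%C)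
            (RtoC (exp (t * b)) * RtoC (rkern b K))%C.
Proof.
  intros Hb Ht. rewrite <- RtoC_mult.
  eapply is_series_ext;
    [|apply is_series_RtoC, is_series_rkern_bern; assumption].
  intros i. now rewrite T_point_mass, kern_RtoC, <- RtoC_mult.
Qed.

(* As [T 0] is the identity, [l] is the sum of the series of [f] itself. *)
Lemma is_series_kern_T (b : R) (K : nat) (f : nat -> C) : 0 < b ->
  (forall n, (K <= n)%nat -> f n = RtoC 0) ->
  exists l : C, forall t, 0 <= t ->
    is_series (fun i => (kern (RtoC b) i * T t f i)%C)
              (RtoC (exp (t * b)) * l)%C.
Proof.
  intros Hb. revert f. induction K as [|K IH]; intros f Hf.
  - exists (RtoC 0 * RtoC (rkern b 0))%C. intros t Ht.
    assert (HS := is_series_kern_T_point_mass b t 0 Hb Ht).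
    apply (is_series_scal (RtoC 0)) in HS.
    replace (RtoC (exp (t * b)) * (RtoC 0 * RtoC (rkern b 0)))%C
      with (scal (RtoC 0) (RtoC (exp (t * b)) * RtoC (rkern b 0))%C)
      by C_ring.
    eapply is_series_ext; [|exact HS]. intros i.
    rewrite (T_ext t f (fun j => (RtoC 0 * point_mass 0 j)%C)).
    + rewrite T_scal. C_ring.
    + intros j. rewrite Hf by lia. ring.
  (* [f] is split into its values below [K], covered by induction, and [f K] times the point mass at
     [K]. *)
  - destruct (IH (fun j => if Nat.eqb j K then RtoC 0 else f j)) as [l Hl].
    + intros n Hn. destruct (Nat.eqb_spec n K); [reflexivity|].
      apply Hf. lia.
    + exists (l + f K * RtoC (rkern b K))%C. intros t Ht.
      assert (HS := is_series_kern_T_point_mass b t K Hb Ht).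
      apply (is_series_scal (f K)) in HS.
      assert (H := is_series_plus _ _ _ _ (Hl t Ht) HS).
      replace (RtoC (exp (t * b)) * (l + f K * RtoC (rkern b K)))%C
        with (plus (RtoC (exp (t * b)) * l)%C
                (scal (f K) (RtoC (exp (t * b)) * RtoC (rkern b K))%C))
        by C_ring.
      eapply is_series_ext; [|exact H]. intros i.
      rewrite (T_ext t f (fun j =>
        ((if Nat.eqb j K then RtoC 0 else f j) + f K * point_mass K j)%C)).
      * rewrite T_plus, T_scal.
        C_ring.
      * intros j. unfold point_mass.
        destruct (Nat.eqb_spec j K) as [->|]; ring.
Qed.

Lemma is_series_Wneg_term (b : R) (K : nat) (f : nat -> C) (n : nat) :
  0 < b -> (forall j, (K <= j)%nat -> f j = RtoC 0) ->
  is_series (Wneg_term b f n) (Wneg b f n).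
Proof.
  intros Hb Hf. apply CSeries_correct.
  destruct (is_series_kern_T b K (fun j => f (n + j)%nat) Hb) as [l Hl].
  - intros j Hj. apply Hf. lia.
  - exists (RtoC (exp (0 * b)) * l)%C.
    eapply is_series_ext; [|apply Hl, Rle_refl].
    intros i. cbv beta. now rewrite T_0.
Qed.

Lemma is_series_Wneg_term_T (b : R) (K : nat) (f : nat -> C) (t : R) (n : nat) :
  0 < b -> (forall j, (K <= j)%nat -> f j = RtoC 0) -> 0 <= t ->
  is_series (Wneg_term b (T t f) n)
            (RtoC (exp (t * b)) * T t (Wneg b f) n)%C.
Proof.
  (* [T_S] brings in the shifted sequence, so the induction is over all [f]. *)
  intros Hb Hf Ht. revert f Hf. induction n as [|n IH]; intros f Hf.
  - destruct (is_series_kern_T b K f Hb Hf) as [l Hl].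
    (* The case [t = 0] identifies [l] as [Wneg b f 0], and [T t] does not change the value at 0. *)
    replace (T t (Wneg b f) 0) with l; [exact (Hl t Ht)|].
    transitivity (Wneg b f 0).
    + symmetry. apply CSeries_unique.
      replace l with (RtoC (exp (0 * b)) * l)%C
        by (rewrite Rmult_0_l, exp_0; ring).
      eapply is_series_ext; [|apply Hl, Rle_refl].
      intros i. cbv beta. now rewrite T_0.
    + unfold T. rewrite sum_O, C_n_n. simpl.
      rewrite Rmult_0_r, Ropp_0, exp_0, !Rmult_1_l. ring.
  - assert (S1 := IH f Hf).
    assert (S2 := IH (fun j => f (S j)) ltac:(intros j Hj; apply Hf; lia)).
    apply (is_series_scal (RtoC (1 - exp (- t)))) in S1.
    apply (is_series_scal (RtoC (exp (- t)))) in S2.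
    assert (H := is_series_plus _ _ _ _ S1 S2). rewrite T_S.
    (* [Wneg] commutes with the shift by computation, since [S j + i] reduces to [S (j + i)]. *)
    rewrite (T_ext t (fun j => Wneg b f (S j)) (Wneg b (fun j => f (S j))))
      by reflexivity.
    match type of H with is_series _ ?x => match goal with
      |- is_series _ ?y => replace y with x
        by C_ring end end.
    eapply is_series_ext; [|exact H]. intros i.
    unfold Wneg_term. change (S n + i)%nat with (S (n + i)). rewrite T_S.
    C_ring.
Qed.

(** * Assembling the general order *)

Lemma finite_support_bound (f : nat -> C) : finite_support f ->
  exists K, forall n, (K <= n)%nat -> f n = RtoC 0.
Proof.
  intros [l Hl]. exists (S (list_max l)). intros n Hn.
  destruct (Ceq_dec (f n) (RtoC 0)) as [|H]; [assumption|].
  apply Hl in H. exfalso.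
  assert (M := proj1 (list_max_le l (list_max l)) (Nat.le_refl _)).
  rewrite Forall_forall in M. specialize (M n H). lia.
Qed.

(** This makes the order [Word a - a] of the inner sum strictly positive, as the binomial series
    requires. *)
Lemma Word_gt (a : R) : 0 <= a -> a < INR (Word a).
Proof.
  intros Ha. destruct (base_Int_part a) as [H1 H2].
  assert (P : (-1 < Int_part a)%Z) by (apply lt_IZR; lra).
  unfold Word. rewrite S_INR, INR_IZR_INZ, Z2Nat.id by lia. lra.
Qed.

Theorem lemma4p4 (alpha : R) (halpha : 0 <= alpha)
    (f : nat -> C) (hf : finite_support f) :
  W_defined alpha f /\
  forall t : R, 0 <= t ->
    W_defined alpha (T t f) /\
    forall n : nat,
      W alpha (T t f) n = (RtoC (exp (- (t * alpha))) * T t (W alpha f) n)%C.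
Proof.
  destruct (finite_support_bound f hf) as [K HK].
  assert (Hb : 0 < INR (Word alpha) - alpha)
    by (assert (H := Word_gt alpha halpha); lra).
  split.
  - intros _ n. eexists. now apply (is_series_Wneg_term _ K).
  - intros t Ht. split.
    + intros _ n. eexists. now apply (is_series_Wneg_term_T _ K).
    + intros n. unfold W. destruct (Req_dec_T alpha 0) as [->|_].
      * rewrite Rmult_0_r, Ropp_0, exp_0. ring.
      * set (b := INR (Word alpha) - alpha) in *.
        (* The negative order is moved past [T t] first, then the iterated difference. *)
        rewrite (Witer_ext _ _
          (fun j => (RtoC (exp (t * b)) * T t (Wneg b f) j)%C)).
        (* With [m = Word alpha] the exponents add up to [t (m - alpha) - t m = - t alpha]. *)
        -- rewrite Witer_scal_T, Cmult_assoc, <- RtoC_mult, <- exp_plus.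
           do 3 f_equal. unfold b. ring.
        -- intros j. now apply CSeries_unique, (is_series_Wneg_term_T _ K).
Qed.
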